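(* Assume that $\mathcal{L}_{\min,\mathcal{M}}$ is finite, that $\mathcal{L}$ is restricted $L$-smooth and satisfies the $\lambda$-Polyak-Łojasiewicz condition, that the retraction error is controlled with constant $C_{\mathrm R}$ and $\beta_t\equiv0$, and that the estimators $P_t^n$, which at each step $t\ge0$ are built from points $x_1,\dots,x_n$ drawn i.i.d. from $\mu_t$ given $\mathcal{F}_t$, have bounded bias and variance with $c_{\mathrm{bias},2}=0$. Define $$\kappa_t:=\frac{\|g_t\|^2}{\|P_tg_t\|^2},\qquad\tilde\sigma_t:=c_{\mathrm{bias},1}s_t-s_t^2\tfrac{L+C_{\mathrm R}}2\big(c_{\mathrm{var},1}+c_{\mathrm{var},2}(\kappa_t-1)\big),\qquad a_t:=1-2\lambda\tfrac{\tilde\sigma_t}{\kappa_t}.$$ If $\kappa_t\in[1,\infty)$ is finite and $\tilde\sigma_t>0$, then $$\mathbb{E}[\mathcal{L}(u_{t+1})-\mathcal{L}_{\min}\mid\mathcal{F}_t]\le a_t\big(\mathcal{L}(u_t)-\mathcal{L}_{\min}\big).$$ Moreover, if (in addition to $\kappa_t<\infty$ and $\tilde\sigma_t>0$) $a_t\le\bar a<b<1$ for all $t$, then almost surely $$\mathcal{L}(u_t)-\mathcal{L}_{\min}\lesssim b^t,$$ i.e. almost surely there is a finite (random) constant $C$ with $\mathcal{L}(u_t)-\mathcal{L}_{\min}\le C\,b^t$ for all $t$.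
   Context: Setting. $\mathcal{X}$ is a set with probability measure $\rho$, $\mathcal{H}$ is a Hilbert space of functions on $\mathcal{X}$ with inner product $(\cdot,\cdot)$ and norm $\|\cdot\|$, $\mathcal{L}:\mathcal{H}\to\mathbb{R}$, $\mathcal{L}(v)=\int \ell(v;x)\,d\rho(x)$ is the expected loss of a loss function $\ell:\mathcal{H}\times\mathcal{X}\to\mathbb{R}$, $\mathcal{M}\subseteq\mathcal{H}$ is a (possibly nonlinear) model class, $\mathcal{L}_{\min}:=\inf_{u\in\mathcal{H}}\mathcal{L}(u)$ and $\mathcal{L}_{\min,\mathcal{M}}:=\inf_{u\in\mathcal{M}}\mathcal{L}(u)$. $(\Omega,\Sigma,\mathbb{P},(\mathcal{F}_t)_{t\ge0})$ is a filtered probability space. Algorithm. Given an $\mathcal{F}_0$-measurable $u_0\in\mathcal{M}$, define for $t\ge0$ $$g_t:=\nabla\mathcal{L}(u_t),\qquad \bar u_{t+1}:=u_t-s_tP_t^ng_t,\qquad u_{t+1}:=R_t(\bar u_{t+1}).$$ Here $\mathcal{L}$ is Fréchet differentiable at $u_t$ and $\nabla\mathcal{L}(u_t)\in\mathcal{H}$ is the Riesz representative of the derivative; $\mathcal{T}_t\subseteq\mathcal{H}$ is an $\mathcal{F}_t$-measurable linear space of finite dimension $d_t$ associated with $u_t$; $P_t:\mathcal{H}\to\mathcal{T}_t$ is the $\mathcal{H}$-orthogonal projection; $P_t^n$ is a random operator with values in $\mathcal{T}_t$ (an estimator of $P_t$), built from $n$ sample points drawn at step $t$ conditionally on $\mathcal{F}_t$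 from an $\mathcal{F}_t$-dependent probability measure $\mu_t$ on $\mathcal{X}$, so that $u_{t+1}$ is $\mathcal{F}_{t+1}$-measurable; the step size $s_t>0$ is $\mathcal{F}_t$-measurable; the retraction $R_t:\mathcal{H}\to\mathcal{M}$ is $\mathcal{F}_t$-measurable. All (conditional) expectations that appear are assumed to exist. Restricted $L$-smoothness: $L>0$ and for all $u_t\in\mathcal{M}$ with associated $\mathcal{T}_t$ and all $g\in\mathcal{T}_t$, $\mathcal{L}(u_t+g)\le\mathcal{L}(u_t)+(\nabla\mathcal{L}(u_t),g)+\frac L2\|g\|^2$. $\lambda$-Polyak-Łojasiewicz condition: $\lambda>0$ and for all $u\in\mathcal{M}$, $\|\nabla\mathcal{L}(u)\|^2\ge2\lambda(\mathcal{L}(u)-\mathcal{L}_{\min})$. Controlled retraction error with $C_{\mathrm R}>0$ and $\beta_t\equiv0$: for all $t$ and $g\in\mathcal{T}_t$, $\mathcal{L}(R_t(u_t+g))\le\mathcal{L}(u_t+g)+\frac{C_{\mathrm R}}2\|g\|^2$. Bounded bias and variance (case $c_{\mathrm{bias},2}=0$): $c_{\mathrm{bias},1},c_{\mathrm{var},1}>0$, $c_{\mathrm{var},2}\ge0$, and for every $t$ and every $\mathcal{F}_t$-measurable $\mathcal{H}$-valued $g$, $\mathbb{E}[(g,P_t^ng)\mid\mathcal{F}_t]\ge c_{\mathrm{bias},1}\|P_tg\|^2$ and $\mathbb{E}[\|P_t^ng\|^2\mid\mathcal{F}_t]\le c_{\mathrm{var},1}\|P_tg\|^2+c_{\mathrm{var},2}\|(I-P_t)g\|^2$.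 *)

(* Defs.v *)
From HB Require Import structures.
From mathcomp Require Import all_boot all_order all_algebra sesquilinear.
From mathcomp Require Import all_classical all_reals all_analysis.
From mathcomp Require Import measurable_realfun.

Set Implicit Arguments.
Unset Strict Implicit.
Unset Printing Implicit Defensive.

Import Order.TTheory GRing.Theory Num.Theory.
Import numFieldNormedType.Exports.

Local Open Scope classical_set_scope.
Local Open Scope ring_scope.

(* Filtrations and conditional expectation. A sub-sigma-algebra of Omega is a
   set of sets [G]; being [G]-measurable is the library's [measurable_fun] on
   the copy of Omega that carries the sigma-algebra generated by [G] (which is
   [G] itself when [G] is a sigma-algebra). *)

Definition borel (T : ptopologicalType) := g_sigma_algebraType (@open T).

Definition fmeasurable (Omega : pointedType) (G : set (set Omega))
    (d : measure_display) (T : measurableType d) (f : Omega -> T) : Prop :=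
  measurable_fun [set: g_sigma_algebraType G]
    (f : g_sigma_algebraType G -> T).

Definition filtration (d : measure_display) (Omega : measurableType d)
    (F : nat -> set (set Omega)) : Prop :=
  [/\ forall t, sigma_algebra setT (F t),
      forall t, F t `<=` measurable
    & forall t, F t `<=` F t.+1].

(* For X >= 0, possibly not integrable: then Y is the usual [0, +oo]-valued
   conditional expectation, unique up to a null set. *)
Definition nneg_cond_exp (d : measure_display) (Omega : measurableType d)
    (R : realType) (P : probability Omega R) (G : set (set Omega))
    (X Y : Omega -> \bar R) : Prop :=
  [/\ measurable_fun setT X,
      fmeasurable G Y,
      forall w, (0 <= Y w)%E
    & forall A, G A -> (\int[P]_(w in A) X w = \int[P]_(w in A) Y w)%E].

(* Y is a version of E[X | G] := E[X^+ | G] - E[X^- | G], which exists when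
   these two are almost surely not both infinite; X need not be integrable. *)
Definition is_cond_exp (d : measure_display) (Omega : measurableType d)
    (R : realType) (P : probability Omega R) (G : set (set Omega))
    (X Y : Omega -> \bar R) : Prop :=
  fmeasurable G Y /\
  exists Yp Yn : Omega -> \bar R,
    [/\ nneg_cond_exp P G (X^\+)%E Yp,
        nneg_cond_exp P G (X^\-)%E Yn
      & {ae P, forall w, (Yp w < +oo \/ Yn w < +oo)%E /\
                         Y w = (Yp w - Yn w)%E}].

(* Given G, the entries of the random tuple x are i.i.d. with law mu. *)
Definition cond_iid (d dX : measure_display) (Omega : measurableType d)
    (X : measurableType dX) (R : realType) (P : probability Omega R)
    (G : set (set Omega)) (mu : R.-pker (g_sigma_algebraType G) ~> X)
    (n : nat) (x : Omega -> n.-tuple X) : Prop :=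
  forall B : 'I_n -> set X, (forall i, measurable (B i)) ->
    is_cond_exp P G
      (fun w => (\1_[set w' | forall i, B i (tnth (x w') i)] w)%:E)
      (fun w => (\prod_(i < n) mu w (B i))%E).

Section hilbert.
Variables (R : realType) (H : completeNormedModType R).

(* Together with completeness of H: H is a real Hilbert space. *)
Definition induces_norm (dot : {dot H for idfun}) : Prop :=
  forall v : H, dot v v = `|v| ^+ 2.

Definition subspace_of_dim (T : set H) (k : nat) : Prop :=
  exists e : 'I_k -> H,
    (forall c : 'I_k -> R,
       \sum_(i < k) c i *: e i = 0 -> forall i, c i = 0) /\
    T = [set \sum_(i < k) c i *: e i | c in [set: 'I_k -> R]].

Variable dot : {dot H for idfun}.

Definition orthoproj (T : set H) (v : H) : H :=
  xget 0 [set p | T p /\ forall q, T q -> dot (v - p) q = 0].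

(* Riesz representative of the Frechet derivative, where [f] is
   differentiable. *)
Definition gradient (f : H -> R) (u : H) : H :=
  xget 0 [set g | forall h, 'd (f : H -> R^o) u h = dot g h].

Definition expected_loss (dX : measure_display) (X : measurableType dX)
    (rho : probability X R) (l : H -> X -> R) (v : H) : R :=
  (\int[rho]_x l v x)%R.

(* Infimum over [M], with value -oo if [f] is unbounded below there. *)
Definition loss_inf (f : H -> R) (M : set H) : \bar R :=
  ereal_inf [set (f u)%:E | u in M].

(* [assoc u] is the collection of linear spaces associated with [u]. *)
Definition restricted_smooth (f : H -> R) (M : set H)
    (assoc : H -> set (set H)) (L : R) : Prop :=
  forall u, M u -> forall T, assoc u T -> forall g, T g ->
    f (u + g) <= f u + dot (gradient f u) g + L / 2 * `|g| ^+ 2.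

Definition polyak_lojasiewicz (f : H -> R) (M : set H) (lambda : R) : Prop :=
  forall u, M u ->
    ((2 * lambda)%:E * ((f u)%:E - loss_inf f setT)
      <= (`|gradient f u| ^+ 2)%:E)%E.

(* |g|^2 / |P_T g|^2, equal to +oo when P_T g = 0 and g <> 0; the quotient
   0 / 0 is read as 1. *)
Definition proj_ratio (T : set H) (g : H) : \bar R :=
  if g == 0 then 1%E
  else ((`|g| ^+ 2)%:E / (`|orthoproj T g| ^+ 2)%:E)%E.

Section processes.
Variables (d : measure_display) (Omega : measurableType d).
Variables (P : probability Omega R) (F : nat -> set (set Omega)).

Definition controlled_retraction (f : H -> R) (u : nat -> Omega -> H)
    (T : nat -> Omega -> set H) (Rt : nat -> Omega -> H -> H)
    (CR : R) (beta : nat -> Omega -> R) : Prop :=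
  forall t w g, T t w g ->
    f (Rt t w (u t w + g)) <= f (u t w + g) + CR / 2 * `|g| ^+ 2 + beta t w.

Definition bounded_bias (T : nat -> Omega -> set H)
    (Pn : nat -> Omega -> H -> H) (c1 : R) : Prop :=
  forall t (g : Omega -> borel H), fmeasurable (F t) g ->
    exists2 Y,
      is_cond_exp P (F t) (fun w => (dot (g w) (Pn t w (g w)))%:E) Y
    & {ae P, forall w, ((c1 * `|orthoproj (T t w) (g w)| ^+ 2)%:E <= Y w)%E}.

Definition bounded_variance (T : nat -> Omega -> set H)
    (Pn : nat -> Omega -> H -> H) (c1 c2 : R) : Prop :=
  forall t (g : Omega -> borel H), fmeasurable (F t) g ->
    exists2 Y,
      is_cond_exp P (F t) (fun w => (`|Pn t w (g w) : H| ^+ 2)%:E) Y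
    & {ae P, forall w,
        (Y w <= (c1 * `|orthoproj (T t w) (g w)| ^+ 2
                 + c2 * `|(g w : H) - orthoproj (T t w) (g w)| ^+ 2)%:E)%E}.

End processes.
End hilbert.

(* Main.v *)
Require Import Defs.
From mathcomp Require Import all_boot all_order all_algebra sesquilinear.
From mathcomp Require Import all_classical all_reals all_analysis.
From mathcomp Require Import measurable_realfun.
From mathcomp Require Import ring lra.

Set Implicit Arguments.
Unset Strict Implicit.
Unset Printing Implicit Defensive.

Import Order.TTheory GRing.Theory Num.Theory.
Import numFieldNormedType.Exports.

Local Open Scope classical_set_scope.
Local Open Scope ring_scope.

(** Write [v_t] for the excess loss at step [t] and [p_t] for the squared norm
of the projected gradient. Controlled retraction followed by restricted
smoothness along the tangent direction [- s_t P_t^n g_t] gives, pointwise,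
[v_{t+1} <= v_t - s_t (g_t, P_t^n g_t) + (L + C_R)/2 s_t^2 |P_t^n g_t|^2]
([retracted_step_le]). Conditioning on [F_t] and inserting the bias and variance
bounds turns the right-hand side into [v_t - sigma_t p_t]: by Pythagoras the
variance term [|(I - P_t) g_t|^2] is [(kappa_t - 1) p_t]. Since
[p_t = |g_t|^2 / kappa_t] and [|g_t|^2 >= 2 lambda v_t], this is at most
[a_t v_t] ([descent_le]).

Two points need care. None of the random variables is assumed integrable, so
conditional expectations are differences of [0, +oo]-valued ones and cannot be
added or compared termwise. Moving the negative parts to the other side leaves
an inequality between nonnegative functions, which can be integrated over any
event of [F_t]; subtraction is then justified almost everywhere because the
dominating function is finite ([le_integral_sub], [cond_descent]). Moreover
[H] may be nonseparable, in which case the projected gradient need not be a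
random variable. It therefore occurs only in almost sure pointwise bounds on
versions of the conditional expectations, never under an integral.

For the almost sure rate with [b > 0], the one-step bound integrates to
[E[v_{t+1}; A] <= c E[v_t; A]] for [A] in [F_t] and some [c < b]. On the event
[v_0 <= k], which belongs to every [F_t], the series of the [v_t / b^t] has
expectation at most [k / (1 - c/b)], so it converges almost surely and its sum
bounds every [v_t / b^t]; these events exhaust the space
([ae_geometric_decay]). *)

(** * Comparing functions through integrals over a sub-sigma-algebra *)

Section sub_sigma_algebra.
Import HBNNSimple.
Context d (Omega : measurableType d) (R : realType) (P : probability Omega R).
Context (G : set (set Omega)) (sG : sigma_algebra setT G).
Hypothesis GM : G `<=` measurable.
Local Open Scope ereal_scope.

Lemma measurable_sub_sigma_algebraE (A : set (g_sigma_algebraType G)) :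
  measurable A = G A.
Proof. by rewrite [LHS](_ : _ = <<s G >> A)// sigma_algebra_id. Qed.

Lemma fmeasurable_measurable dT (T : measurableType dT) (f : Omega -> T) :
  fmeasurable G f -> measurable_fun setT f.
Proof.
move=> mf _ Y mY; have := mf measurableT Y mY.
by rewrite measurable_sub_sigma_algebraE => /GM.
Qed.

(** The set where [f] exceeds [h] is the countable union of the sets
[h <= k, h + 1/(k+1) <= f]; on each of them [h] has a finite integral, which
can be cancelled, so the set is null. Hence [f] and [h] may both be
non-integrable. *)
Lemma ae_le_of_le_integral (f h : Omega -> \bar R) :
  fmeasurable G f -> fmeasurable G h ->
  (forall w, 0 <= f w) -> (forall w, 0 <= h w) ->
  (forall A, G A -> \int[P]_(w in A) f w <= \int[P]_(w in A) h w) ->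
  {ae P, forall w, f w <= h w}.
Proof.
move=> mf mh f0 h0 fh.
pose B k := [set w | h w <= k%:R%:E] `&` [set w | h w + k.+1%:R^-1%:E <= f w].
have GB k : G (B k).
  rewrite -measurable_sub_sigma_algebraE; apply: measurableI.
    rewrite -[X in measurable X]setTI.
    by apply: (@measurable_lee _ (g_sigma_algebraType G)).
  rewrite -[X in measurable X]setTI.
  apply: (@measurable_lee _ (g_sigma_algebraType G)) => //.
  exact: (@emeasurable_funD _ (g_sigma_algebraType G)).
have mB k : measurable (B k) by exact: GM.
have mf' : measurable_fun setT f by exact: fmeasurable_measurable.
have mh' : measurable_fun setT h by exact: fmeasurable_measurable.
have PB k : P (B k) = 0.
  have hfin : \int[P]_(w in B k) h w \is a fin_num.
    rewrite ge0_fin_numE; last exact: integral_ge0.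
    apply: (@le_lt_trans _ _ (k%:R%:E * P (B k))).
      rewrite -integral_cst//; apply: ge0_le_integral => //.
      - exact: measurable_funTS mh'.
      - by move=> w [].
    by rewrite -ge0_fin_numE ?mule_ge0// fin_numM// fin_num_measure.
  have : \int[P]_(w in B k) h w + k.+1%:R^-1%:E * P (B k)
         <= \int[P]_(w in B k) h w.
    apply: le_trans (fh _ (GB k)).
    rewrite -integral_cst// -ge0_integralD//.
    2: exact: measurable_funTS mh'.
    2: by move=> w _; rewrite lee_fin.
    apply: ge0_le_integral => //.
    - by move=> w _; rewrite adde_ge0// lee_fin.
    - by apply: emeasurable_funD => //; exact: measurable_funTS mh'.
    - exact: measurable_funTS mf'.
    - by move=> w [].
  rewrite -[leRHS]adde0 leeD2lE// pmule_rle0 ?lte_fin ?invr_gt0//.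
  by move=> PB0; apply/eqP; rewrite eq_le PB0/=.
have : {ae P, forall w, forall k, ~ B k w}.
  apply: ae_foralln => k; exists (B k); split; [exact: mB|exact: PB|].
  by move=> w /= /contrapT.
apply: filterS => w nB; rewrite leNgt; apply/negP => hf.
have [r hw] : exists r, h w = r%:E.
  move: hf (h0 w); case: (h w) => [q||]//; first by exists q.
  by rewrite ltNge leey.
have [e e0 he] : exists2 e : R, (0 < e)%R & h w + e%:E <= f w.
  move: hf; rewrite hw; case: (f w) => [q|_|]//.
    rewrite lte_fin => rq; exists (q - r)%R; first by rewrite subr_gt0.
    by rewrite -EFinD lee_fin addrC subrK.
  by exists 1%R => //; rewrite leey.
have [k [k1 k2]] : exists k, (r <= k%:R)%R /\ (k.+1%:R^-1 <= e)%R.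
  exists (maxn (Num.truncn r).+1 (Num.truncn e^-1)); split.
    apply: (@le_trans _ _ (Num.truncn r).+1%:R).
      by apply/ltW; exact: truncnS_gt.
    by rewrite ler_nat leq_maxl.
  rewrite -[leRHS]invrK lef_pV2 ?posrE ?invr_gt0//.
  apply: (@le_trans _ _ (Num.truncn e^-1).+1%:R).
    by apply/ltW; exact: truncnS_gt.
  by rewrite ler_nat ltnS leq_maxr.
apply: (nB k); split; rewrite /= hw ?lee_fin//.
by apply: le_trans he; rewrite hw -EFinD lee_fin lerD2l.
Qed.

(** For a simple factor the identity is the defining property of [Y], summed
over the level sets of the factor; monotone convergence gives the rest. *)
Lemma nneg_cond_exp_pull_out (X Y s : Omega -> \bar R) :
  nneg_cond_exp P G X Y -> (forall w, 0 <= X w) ->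
  fmeasurable G s -> (forall w, 0 <= s w) ->
  forall A, G A ->
    \int[P]_(w in A) (s w * X w) = \int[P]_(w in A) (s w * Y w).
Proof.
move=> [mX mY Y0 XY] X0 ms s0 A GA.
have mA : measurable A by exact: GM.
have mY' : measurable_fun setT Y by exact: fmeasurable_measurable.
pose h := nnsfun_approx (@measurableT _ (g_sigma_algebraType G)) ms.
have nd_h (a b : nat) : (a <= b)%N -> forall w, (h a w <= h b w)%R.
  move=> ab w; have /lefP := nd_nnsfun_approx
    (@measurableT _ (g_sigma_algebraType G)) ms ab.
  exact.
have mh n : measurable_fun A (EFin \o h n : Omega -> \bar R).
  apply/measurable_EFinP/measurable_funTS/fmeasurable_measurable.
  exact: measurable_funP.
have limE Z : (forall w, 0 <= Z w) -> measurable_fun setT Z ->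
    \int[P]_(w in A) (s w * Z w) =
    lim (\int[P]_(w in A) ((h n w)%:E * Z w) @[n --> \oo]).
  move=> Z0 mZ.
  have sZ w : s w * Z w = lim ((h n w)%:E * Z w @[n --> \oo]).
    apply/esym/cvg_lim => //.
    have hs : (h n w)%:E @[n --> \oo] --> s w by exact: cvg_nnsfun_approx.
    have nd : {homo (fun n => (h n w)%:E) : a b / (a <= b)%N >-> a <= b}.
      by move=> a b ab; rewrite lee_fin; exact: nd_h.
    have [->|Zw0] := eqVneq (Z w) 0.
      by rewrite mule0; under eq_fun do rewrite mule0; exact: cvg_cst.
    (* [s w = 0] with [Z w = +oo] is the case where multiplication is not
       continuous; there the approximants vanish identically *)
    have [s0w|sw0] := eqVneq (s w) 0; last first.
      apply: cvgeM => //; last exact: cvg_cst.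
      by apply: neq0_mule_def; rewrite mule_neq0.
    have h0 n : (h n w)%:E = 0.
      apply/eqP; rewrite eq_le [X in _ && X]lee_fin fun_ge0 andbT -s0w.
      rewrite -(cvg_lim _ hs)//; apply: lime_ge.
        by apply/cvg_ex; exists (s w).
      by near=> m; apply: nd; near: m; exact: nbhs_infty_ge.
    under eq_fun do rewrite h0 mul0e.
    by rewrite s0w mul0e; exact: cvg_cst.
  under eq_integral => w _ do rewrite sZ.
  apply: monotone_convergence => //.
  - by move=> n; apply: emeasurable_funM; [exact: mh|exact: measurable_funTS mZ].
  - by move=> n x _; rewrite mule_ge0// lee_fin.
  - move=> x _ a b ab; rewrite lee_wpmul2r// lee_fin.
    exact: nd_h.
rewrite !limE//.
suff eqn n : \int[P]_(w in A) ((h n w)%:E * X w) =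
             \int[P]_(w in A) ((h n w)%:E * Y w).
  by under eq_fun do rewrite eqn.
have step Z : (forall w, 0 <= Z w) -> measurable_fun setT Z ->
    \int[P]_(w in A) ((h n w)%:E * Z w) =
    \sum_(y \in range (h n))
      (y%:E * \int[P]_(w in A `&` h n @^-1` [set y]) Z w).
  move=> Z0 mZ.
  have mhy y : measurable (h n @^-1` [set y] : set Omega).
    by apply: GM; rewrite -measurable_sub_sigma_algebraE; exact: measurable_funPTI.
  transitivity (\int[P]_(w in A)
      (\sum_(y \in range (h n)) (y%:E * (Z \_ (h n @^-1` [set y])) w))).
    apply: eq_integral => w _.
    rewrite {1}(fimfunE (h n) w) -fsumEFin// ge0_mule_fsuml; last first.
      by move=> y; exact: (nnfun_muleindic_ge0 (h n)).
    apply: eq_fsbigr => y _; rewrite EFinM -muleA; congr (_ * _).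
    by rewrite epatch_indic muleC.
  rewrite ge0_integral_fsum//; last 2 first.
  - move=> y; apply: emeasurable_funM => //; apply: measurable_funTS.
    by apply/(measurable_restrictT _ (mhy y)); exact: measurable_funTS mZ.
  - move=> y w _; have [yh|yh] := pselect (exists w, h n w = y).
      case: yh => w' <-; rewrite mule_ge0 ?lee_fin//.
      by rewrite /patch; case: ifP.
    rewrite /patch; case: ifPn => [|_]; last by rewrite mule0.
    by rewrite inE /= => hw; exfalso; apply: yh; exists w.
  apply: eq_fsbigr => y; rewrite inE => -[w' _ <-].
  rewrite ge0_integralZl//.
  - by rewrite -integral_mkcondr.
  - apply: measurable_funTS; apply/(measurable_restrictT _ (mhy _)).
    exact: measurable_funTS mZ.
  - by move=> w _; rewrite /patch; case: ifP.
  - by rewrite lee_fin.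
rewrite !step//; apply: eq_fsbigr => y _; rewrite XY//.
rewrite -measurable_sub_sigma_algebraE; apply: measurableI;
    first by rewrite measurable_sub_sigma_algebraE.
exact: measurable_funPTI.
Unshelve. all: by end_near.
Qed.

(** On the events [Z <= k] the integral of [U] is finite and can be subtracted;
they exhaust the space up to a null set because [Z] is almost surely finite.
The maximum with [0] makes the bound a nonnegative function everywhere, whereas
[Z - U] is nonnegative only almost surely. *)
Lemma le_integral_sub (X U Z : Omega -> \bar R) :
  measurable_fun setT X -> fmeasurable G U -> fmeasurable G Z ->
  (forall w, 0 <= X w) -> (forall w, 0 <= U w) -> (forall w, 0 <= Z w) ->
  {ae P, forall w, Z w < +oo} ->
  (forall A, G A ->
    \int[P]_(w in A) X w + \int[P]_(w in A) U w <= \int[P]_(w in A) Z w) ->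
  {ae P, forall w, U w <= Z w} /\
  (forall A, G A -> \int[P]_(w in A) X w
                    <= \int[P]_(w in A) Order.max 0 (Z w - U w)).
Proof.
move=> mX mU mZ X0 U0 Z0 Zfin XUZ.
have mU' := fmeasurable_measurable mU.
have mZ' := fmeasurable_measurable mZ.
have UZ : {ae P, forall w, U w <= Z w}.
  apply: ae_le_of_le_integral => // A GA.
  by apply: le_trans (XUZ _ GA); rewrite leeDr// integral_ge0.
split=> // A GA.
pose h w := Order.max 0 (Z w - U w).
have mh : measurable_fun setT h.
  by apply: measurable_maxe => //; exact: emeasurable_funB.
have h0 w : 0 <= h w by rewrite le_max lexx.
pose B (k : nat) := A `&` [set w | Z w <= k%:R%:E].
have mA : measurable A by exact: GM.
have GB k : G (B k).
  rewrite -measurable_sub_sigma_algebraE; apply: measurableI;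
    first by rewrite measurable_sub_sigma_algebraE.
  rewrite -[X in measurable X]setTI.
  by apply: (@measurable_lee _ (g_sigma_algebraType G)).
have mB k : measurable (B k) by exact: GM.
have XB k : \int[P]_(w in B k) X w <= \int[P]_(w in A) h w.
  have Zk : \int[P]_(w in B k) Z w < +oo.
    apply: (@le_lt_trans _ _ (k%:R%:E * P (B k))).
      rewrite -integral_cst//; apply: ge0_le_integral => //.
      - exact: measurable_funTS mZ'.
      - by move=> w [].
    by rewrite -ge0_fin_numE ?mule_ge0// fin_numM// fin_num_measure.
  have Uk : \int[P]_(w in B k) U w \is a fin_num.
    rewrite ge0_fin_numE; last exact: integral_ge0.
    apply: le_lt_trans Zk; apply: le_trans (XUZ _ (GB k)).
    by rewrite leeDr// integral_ge0.
  apply: (@le_trans _ _ (\int[P]_(w in B k) h w)); last first.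
    apply: ge0_subset_integral => //; first exact: measurable_funTS mh.
    by move=> w [].
  rewrite -(leeD2rE _ _ Uk) (le_trans (XUZ _ (GB k)))//.
  rewrite -ge0_integralD//; last 2 first.
  - exact: measurable_funTS mh.
  - exact: measurable_funTS mU'.
  apply: ge0_le_integral => //; first exact: measurable_funTS mZ'.
    by apply: emeasurable_funD;
      [exact: measurable_funTS mh|exact: measurable_funTS mU'].
  move=> w [_ /= Zwk].
  have Zf : Z w \is a fin_num by rewrite ge0_fin_numE// (le_lt_trans Zwk)// ltry.
  have [UZw|ZUw] := leP (U w) (Z w).
    have Uf : U w \is a fin_num.
      by rewrite ge0_fin_numE// (le_lt_trans UZw)// -ge0_fin_numE.
    by rewrite /h max_r ?subre_ge0// subeK.
  by rewrite (le_trans (ltW ZUw))// leeDr.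
have ndB : nondecreasing_seq B.
  move=> a b ab; rewrite subsetEset => w [Aw /= Za]; split=> //=.
  by rewrite (le_trans Za)// lee_fin ler_nat.
have cvgB : \int[P]_(w in B k) X w @[k --> \oo]
    --> \int[P]_(w in \bigcup_k B k) X w.
  by apply: ge0_nondecreasing_set_cvg_integral => // k; exact: measurable_funTS mX.
have BE : \bigcup_i B i = A `&` [set w | Z w < +oo].
  apply/seteqP; split=> [w [k _ [Aw /= Zk]]|w [Aw /= Zy]].
    by split=> //=; rewrite (le_lt_trans Zk)// ltry.
  exists (Num.truncn (fine (Z w))).+1 => //; split=> //=.
  rewrite -[leLHS]fineK ?ge0_fin_numE// lee_fin.
  by apply/ltW; exact: truncnS_gt.
have mZy : measurable [set w | Z w < +oo].
  by rewrite -[X in measurable X]setTI; exact: emeasurable_fun_infty_o.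
have -> : \int[P]_(w in A) X w = \int[P]_(w in \bigcup_i B i) X w.
  rewrite BE (@ge0_negligible_integral _ _ _ _ A (~` [set w | Z w < +oo]))//.
  - by rewrite setDE setCK.
  - exact: measurableC.
  - exact: measurable_funTS mX.
  - apply: measure_negligible; first exact: measurableC.
    by apply: negligibleS Zfin => w /=.
rewrite -(cvg_lim _ cvgB)//; apply: lime_le.
  by apply/cvg_ex; eexists; exact: cvgB.
by near=> n; exact: XB.
Unshelve. all: by end_near.
Qed.

(** The function [h] plays the part of the conditional expectation of [v']
given [G]: its integrals over events of [G] dominate those of [v'], and it is
almost surely below what replacing [D] and [N] by their conditional bounds
gives. The functions [pD] and [pN] are arbitrary: they are compared with the
versions [YD] and [YN] only pointwise. *)
Lemma cond_descent (v' v s D N pD pN : Omega -> R) (c : R)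
    (YD YN : Omega -> \bar R) :
  measurable_fun setT v' -> fmeasurable G v -> fmeasurable G s ->
  (forall w, 0 <= v' w)%R -> (forall w, 0 <= v w)%R ->
  (forall w, 0 <= s w)%R -> (forall w, 0 <= N w)%R -> (0 <= c)%R ->
  (forall w, v' w <= v w - s w * D w + c * s w ^+ 2 * N w)%R ->
  is_cond_exp P G (EFin \o D) YD -> is_cond_exp P G (EFin \o N) YN ->
  {ae P, forall w, (pD w)%:E <= YD w} -> {ae P, forall w, YN w <= (pN w)%:E} ->
  exists h : Omega -> \bar R,
    [/\ fmeasurable G h, forall w, 0 <= h w,
        forall A, G A ->
          \int[P]_(w in A) (v' w)%:E <= \int[P]_(w in A) h w
      & {ae P, forall w,
           h w <= (v w - s w * pD w + c * s w ^+ 2 * pN w)%:E}].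
Proof.
move=> mv' mv ms v'0 v0 s0 N0 c0 descent.
move=> [mYD [Dp [Dn [ceDp ceDn DE]]]] [mYN [Np [Nn [ceNp ceNn NE]]]] pDY pNY.
have [mDp mDp' Dp0 _] := ceDp.
have [mDn mDn' Dn0 _] := ceDn.
have [mNp mNp' Np0 _] := ceNp.
have [mNn mNn' Nn0 Nnint] := ceNn.
have Nn_eq0 : {ae P, forall w, Nn w <= 0}.
  apply: (@ae_le_of_le_integral Nn (cst 0)) => //.
    exact: (@measurable_cst _ _ (g_sigma_algebraType G)).
  move=> A GA.
  rewrite -Nnint// integral0_eq; first exact: integral_ge0.
  move=> w _; by rewrite funenegE /= max_r// lee_fin oppr_le0.
(* Integrate [v' + s D^+ <= v + s D^- + c s^2 N], whose terms are all
   nonnegative; [U] and [Z] are the conditional versions of [s D^+] and of the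
   right-hand side. *)
pose es w := (s w)%:E; pose es2 w := (c * s w ^+ 2)%:E.
have mes : fmeasurable G es.
  exact/(measurable_EFinP (T := g_sigma_algebraType G)).
have mes2 : fmeasurable G es2.
  apply/(measurable_EFinP (T := g_sigma_algebraType G)).
  apply: (@measurable_funM _ (g_sigma_algebraType G)) => //.
  exact: (@measurable_funX _ (g_sigma_algebraType G)).
have es0 w : 0 <= es w by rewrite lee_fin.
have es20 w : 0 <= es2 w by rewrite lee_fin mulr_ge0// sqr_ge0.
pose ev w := (v w)%:E.
have mev : fmeasurable G ev.
  exact/(measurable_EFinP (T := g_sigma_algebraType G)).
have ev0 w : 0 <= ev w by rewrite lee_fin.
pose U w := es w * Dp w.
pose Z w := ev w + es w * Dn w + es2 w * Np w.
have mU : fmeasurable G U by exact: (@emeasurable_funM _ (g_sigma_algebraType G)).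
have mesDn : fmeasurable G (fun w => es w * Dn w).
  exact: (@emeasurable_funM _ (g_sigma_algebraType G)).
have mes2Np : fmeasurable G (fun w => es2 w * Np w).
  exact: (@emeasurable_funM _ (g_sigma_algebraType G)).
have mZ : fmeasurable G Z.
  apply: (@emeasurable_funD _ (g_sigma_algebraType G)) => //.
  exact: (@emeasurable_funD _ (g_sigma_algebraType G)).
have U0 w : 0 <= U w by rewrite mule_ge0.
have Z0 w : 0 <= Z w by rewrite !adde_ge0// mule_ge0.
(* The lower bound on [YD] rules out [Dn = +oo], which makes [Z] finite. *)
have fin : {ae P, forall w, [/\ Dp w \is a fin_num \/ Dp w = +oo,
    Dn w \is a fin_num, Np w \is a fin_num,
    (pD w)%:E <= Dp w - Dn w & Np w <= (pN w)%:E]}.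
  apply: filterS3 (filterI pDY pNY) DE (filterI NE Nn_eq0).
  move=> w [pDw pNw] [Doo YDE] [[_ YNE] Nnw].
  rewrite YDE in pDw; rewrite YNE in pNw.
  have Nn0w : Nn w = 0 by apply/eqP; rewrite eq_le Nnw Nn0.
  rewrite Nn0w sube0 in pNw.
  split=> //.
  - by move: (Dp0 w); case: (Dp w) => [r||] // _; [left|right].
  - rewrite ge0_fin_numE// ltNge leye_eq; apply/negP => /eqP Dny.
    rewrite Dny in Doo pDw; case: Doo => [Dpy|//].
    by move: pDw; case: (Dp w) Dpy.
  - by rewrite ge0_fin_numE// (le_lt_trans pNw)// ltry.
have Zfin : {ae P, forall w, Z w < +oo}.
  move: fin; apply: filterS => w [_ Dnf Npf _ _].
  by rewrite -ge0_fin_numE// !fin_numD !fin_numM.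
have XUZ A : G A -> \int[P]_(w in A) (v' w)%:E + \int[P]_(w in A) U w
    <= \int[P]_(w in A) Z w.
  move=> GA; have mA : measurable A by exact: GM.
  have mT (f : Omega -> \bar R) : measurable_fun setT f -> measurable_fun A f.
    exact: measurable_funTS.
  have mv'e : measurable_fun setT (fun w => (v' w)%:E).
    exact/measurable_EFinP.
  rewrite /U -(nneg_cond_exp_pull_out ceDp)//.
  rewrite /Z ge0_integralD//; last 4 first.
  - by move=> w _; rewrite adde_ge0// mule_ge0.
  - apply: mT; apply: emeasurable_funD => //; exact: fmeasurable_measurable.
  - by move=> w _; rewrite mule_ge0.
  - by apply: mT; exact: fmeasurable_measurable.
  rewrite ge0_integralD//; last 3 first.
  - by apply: mT; exact: fmeasurable_measurable.
  - by move=> w _; rewrite mule_ge0.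
  - by apply: mT; exact: fmeasurable_measurable.
  rewrite -(nneg_cond_exp_pull_out ceDn)// -(nneg_cond_exp_pull_out ceNp)//.
  have mesf := fmeasurable_measurable mes.
  have mes2f := fmeasurable_measurable mes2.
  have mevf := fmeasurable_measurable mev.
  have pos f w : 0 <= (f^\+) w :> \bar R by exact: funepos_ge0.
  have neg f w : 0 <= (f^\-) w :> \bar R by exact: funeneg_ge0.
  rewrite -!ge0_integralD//;
    do ?[by move=> w _; rewrite ?lee_fin ?adde_ge0 ?mule_ge0];
    do ?[by apply: mT => //; do ?apply: emeasurable_funD => //;
            apply: emeasurable_funM].
  apply: ge0_le_integral => //.
  - by move=> w _; rewrite adde_ge0 ?mule_ge0// lee_fin.
  - by apply: mT => //; do ?apply: emeasurable_funD => //; apply: emeasurable_funM.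
  - by apply: mT => //; do ?apply: emeasurable_funD => //; apply: emeasurable_funM.
  move=> w _; rewrite funeposE funenegE funeposE /= /es /es2 /ev.
  rewrite -!EFin_max -!EFinM -!EFinD lee_fin.
  have := descent w.
  have [D0|D0] := leP 0%R (D w); rewrite ?(max_l N0)//.
  - rewrite (max_r (_ : - D w <= 0)%R) ?oppr_le0// mulr0 addr0.
    rewrite (max_l (N0 w)).
    by move=> ?; lra.
  - rewrite (max_l (_ : 0 <= - D w)%R) ?oppr_ge0 ?(ltW D0)// mulr0 addr0.
    rewrite (max_l (N0 w)).
    by move=> ?; lra.
have v'0E w : 0 <= (v' w)%:E by rewrite lee_fin.
have mv'E : measurable_fun setT (fun w => (v' w)%:E) by exact/measurable_EFinP.
have [UZ dom] := le_integral_sub mv'E mU mZ v'0E U0 Z0 Zfin XUZ.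
exists (fun w => Order.max 0 (Z w - U w)); split => //.
- apply: (@measurable_maxe _ (g_sigma_algebraType G)) => //.
  exact: (@emeasurable_funB _ (g_sigma_algebraType G)).
- by move=> w; rewrite le_max lexx.
move: fin UZ; apply: filterS2 => w [Dpf Dnf Npf pDw pNw] UZw.
rewrite max_r ?subre_ge0//; last first.
  by rewrite !fin_numD !fin_numM.
have [s0w|sw0] := eqVneq (s w) 0%R.
  rewrite /Z /U /es /es2 /ev s0w expr0n/= !mulr0 !mul0e !mul0r.
  by rewrite !adde0 sube0 subr0 addr0.
have {}Dpf : Dp w \is a fin_num.
  case: Dpf => // Dpy; move: UZw; rewrite /U Dpy.
  rewrite gt0_muley ?lte_fin ?lt0r ?sw0 ?s0// leye_eq => /eqP Zy.
  have : Z w \is a fin_num by rewrite !fin_numD !fin_numM.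
  by rewrite Zy.
move: pDw pNw; rewrite /Z /U /es /es2 /ev.
rewrite -(fineK Dpf) -(fineK Dnf) -(fineK Npf).
rewrite -EFinB -!EFinM -!EFinD !lee_fin => pDw pNw.
have sD : (s w * pD w <= s w * (fine (Dp w) - fine (Dn w)))%R.
  by rewrite ler_wpM2l.
have cN : (c * s w ^+ 2 * fine (Np w) <= c * s w ^+ 2 * pN w)%R.
  by rewrite ler_wpM2l// mulr_ge0// sqr_ge0.
lra.
Qed.
End sub_sigma_algebra.

(** * Deterministic estimates in a Hilbert space *)

Section hilbert_space.
Context (R : realType) (H : completeNormedModType R) (dot : {dot H for idfun}).
Hypothesis dot_norm : induces_norm dot.

(** Pythagoras holds for every set [T]: when no orthogonal projection of [v]
exists, [orthoproj] takes the default value [0]. *)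
Lemma sqr_norm_sub_orthoproj (T : set H) (v : H) :
  `|v - orthoproj dot T v| ^+ 2 = `|v| ^+ 2 - `|orthoproj dot T v| ^+ 2.
Proof.
rewrite /orthoproj; case: xgetP => [p _ [Tp orth]|_]; last first.
  by rewrite normr0 expr0n/= !subr0.
apply/eqP; rewrite eq_sym subr_eq -!dot_norm; apply/eqP.
rewrite -[in LHS](subrK p v).
by have := hnormDd (orth _ Tp).
Qed.

Lemma subspace_scale (T : set H) k c v : subspace_of_dim T k -> T v -> T (c *: v).
Proof.
move=> [e [_ ->]] [b _ <-]; exists (fun i => c * b i) => //.
by rewrite scaler_sumr; apply: eq_bigr => i _; rewrite scalerA.
Qed.

Lemma retracted_step_le (f : H -> R) (u q : H) (r : H -> H) (T : set H)
    (k : nat) (L CR s : R) :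
  subspace_of_dim T k -> T q ->
  (forall v, T v -> f (u + v)
     <= f u + dot (gradient dot f u) v + L / 2 * `|v| ^+ 2) ->
  (forall v, T v -> f (r (u + v)) <= f (u + v) + CR / 2 * `|v| ^+ 2) ->
  f (r (u - s *: q)) <= f u - s * dot (gradient dot f u) q
                        + (L + CR) / 2 * s ^+ 2 * `|q| ^+ 2.
Proof.
move=> Tdim Tq smooth retr.
have Tv : T (- s *: q) by apply: subspace_scale Tq; exact: Tdim.
move: (smooth _ Tv) (retr _ Tv); rewrite scaleNr linearNr linearZr_LR normrN normrZ.
rewrite exprMn real_normK ?num_real//= => h1 h2.
rewrite (le_trans h2)//.
by move: h1; set a := f (u - _); lra.
Qed.

(** The left-hand side is [v - sigma |P_T g|^2], and
[|P_T g|^2 = |g|^2 / kappa >= 2 lambda v / kappa]. When [g = 0], where [kappa]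
is [1] by convention, the Polyak-Lojasiewicz bound forces [v = 0]. *)
Lemma descent_le (T : set H) (g : H) (s L CR lambda c1 cv1 cv2 v : R) :
  let kappa := proj_ratio dot T g in
  let sigma := c1 * s
    - s ^+ 2 * ((L + CR) / 2) * (cv1 + cv2 * (fine kappa - 1)) in
  0 < lambda -> 0 <= v -> 2 * lambda * v <= `|g| ^+ 2 ->
  (1 <= kappa < +oo)%E -> 0 < sigma ->
  v - s * (c1 * `|orthoproj dot T g| ^+ 2)
    + (L + CR) / 2 * s ^+ 2 * (cv1 * `|orthoproj dot T g| ^+ 2
                               + cv2 * `|g - orthoproj dot T g| ^+ 2)
  <= (1 - 2 * lambda * (sigma / fine kappa)) * v.
Proof.
move=> kappa sigma lambda0 v0 PL kappa_fin sigma0.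
rewrite sqr_norm_sub_orthoproj.
have [g0|g0] := eqVneq g 0.
  have v_eq0 : v = 0.
    apply/eqP; rewrite eq_le v0 andbT.
    move: PL; rewrite g0 normr0 expr0n/= pmulr_rle0//; lra.
  have p0 : `|orthoproj dot T g| ^+ 2 = 0.
    apply/eqP; rewrite eq_le sqr_ge0 andbT.
    have := sqr_ge0 `|g - orthoproj dot T g|.
    by rewrite sqr_norm_sub_orthoproj g0 normr0 expr0n/= sub0r oppr_ge0.
  rewrite p0 v_eq0 g0 normr0 expr0n/= le_eqVlt; apply/orP; left; apply/eqP.
  by ring.
move: (erefl kappa); rewrite {2}/kappa /proj_ratio (negbTE g0).
set p := `|orthoproj dot T g| ^+ 2; set G := `|g| ^+ 2 => kappaE.
have G0 : 0 < G by rewrite exprn_gt0// normr_gt0.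
have p0 : p != 0.
  apply/eqP => p0; move: kappa_fin; rewrite kappaE p0 inver eqxx.
  by rewrite gt0_muley// ltxx andbF.
have kE : fine kappa = G / p by rewrite kappaE inver (negbTE p0).
have pE : p = G / fine kappa.
  by rewrite kE; field; rewrite p0 gt_eqF.
have GE : G = fine kappa * p by rewrite kE; field.
have k0 : 0 < fine kappa.
  rewrite kE divr_gt0// lt0r p0 /p sqr_ge0//.
have -> : v - s * (c1 * p) + (L + CR) / 2 * s ^+ 2 * (cv1 * p + cv2 * (G - p))
   = v - sigma * p.
  by rewrite GE /sigma; ring.
have -> : (1 - 2 * lambda * (sigma / fine kappa)) * v =
   v - (sigma / fine kappa) * (2 * lambda * v) by ring.
have -> : sigma * p = sigma / fine kappa * G by rewrite pE mulrA mulrAC.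
rewrite lerD2l lerN2.
by rewrite ler_wpM2l// divr_ge0// ltW.
Qed.

(** Continuity at the points of [M] makes the preimage under [f] of an open set
agree on [M] with its interior, and [U] only visits [M]. *)
Lemma measurable_comp_continuous_on dO (Omega : measurableType dO)
    (G : set (set Omega)) (M : set H) (f : H -> R) (U : Omega -> borel H) :
  (forall u, M u -> {for u, continuous (f : H -> R^o)}) ->
  fmeasurable G U -> (forall w, M (U w)) ->
  fmeasurable G (fun w => f (U w)).
Proof.
move=> cf mU MU.
rewrite /fmeasurable.
apply: (measurability _ (RGenOInfty.measurableE R)) => // _ [_ [x ->] <-].
rewrite setTI.
have -> : (fun w => f (U w)) @^-1` `]x, +oo[%classic
    = U @^-1` ((f @^-1` `]x, +oo[%classic)^° : set H).
  apply/seteqP; split=> w /= fU; last exact: interior_subset fU.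
  rewrite /interior; apply: (cf _ (MU w)).
  apply: open_nbhs_nbhs; split; [exact: rray_open|exact: fU].
rewrite -[X in measurable X]setTI; apply: mU => //.
apply: sub_sigma_algebra; exact: open_interior.
Qed.

(** If the infimum were [-oo], the left-hand side of the Polyak-Lojasiewicz
inequality would be [+oo] at any point of [M]. *)
Lemma loss_inf_fin_num (f : H -> R) (M : set H) (lambda : R) :
  0 < lambda -> M !=set0 -> polyak_lojasiewicz dot f M lambda ->
  loss_inf f setT \is a fin_num.
Proof.
move=> lambda0 [u Mu] /(_ _ Mu) PL.
have le_u : (loss_inf f setT <= (f u)%:E)%E by apply: ereal_inf_lbound; exists u.
move: PL le_u; case: (loss_inf f setT) => //=.
by rewrite addey// gt0_muley ?lte_fin ?mulr_gt0.
Qed.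

End hilbert_space.

(** * Almost sure geometric decay *)

Section geometric_decay.
Context d (Omega : measurableType d) (R : realType) (P : probability Omega R).
Context (F : nat -> set (set Omega)) (F_filtration : filtration F).
Local Open Scope ereal_scope.

Lemma filtration_le s t : (s <= t)%N -> F s `<=` F t.
Proof.
have [_ _ Fincr] := F_filtration.
elim: t => [|t IH]; first by rewrite leqn0 => /eqP ->.
rewrite leq_eqVlt => /predU1P[->//|].
by rewrite ltnS => /IH st A /st; exact: Fincr.
Qed.

(** Localizing to the events [v_0 <= k] replaces integrability of [v_0]. There
the integral of [v_t] is at most [k c^t], so the series of the [v_t / b^t] is
integrable, hence almost surely finite. *)
Lemma ae_geometric_decay (v : nat -> Omega -> R) (c b : R) :
  (0 < c)%R -> (c < b)%R -> (forall t w, 0 <= v t w)%R ->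
  (forall t, fmeasurable (F t) (v t)) ->
  (forall t A, F t A ->
    \int[P]_(w in A) (v t.+1 w)%:E <= c%:E * \int[P]_(w in A) (v t w)%:E) ->
  {ae P, forall w, exists C : R, forall t, (v t w <= C * b ^+ t)%R}.
Proof.
move=> c0 cb v0 mv contr.
have [Fsig FM _] := F_filtration.
have b0 : (0 < b)%R by exact: lt_trans cb.
pose B (k : nat) := [set w | (v 0%N w <= k%:R)%R].
have FB k : F 0%N (B k).
  rewrite -(measurable_sub_sigma_algebraE (Fsig 0%N)) -[X in measurable X]setTI.
  by apply: (@measurable_fun_le _ (g_sigma_algebraType (F 0%N))) => //; exact: mv.
have mB k : measurable (B k) by exact/(FM 0%N).
have mvE t : measurable_fun setT (fun w => (v t w)%:E).
  apply/measurable_EFinP.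
  exact: fmeasurable_measurable (Fsig t) (FM t) _ _ _ (mv t).
have intB k t : \int[P]_(w in B k) (v t w)%:E <= (k%:R * c ^+ t)%:E.
  elim: t => [|t IH].
    rewrite expr0 mulr1; apply: (@le_trans _ _ (k%:R%:E * P (B k))).
      rewrite -integral_cst//; apply: ge0_le_integral => //.
      - by move=> w _; rewrite lee_fin.
      - exact: measurable_funTS (mvE 0%N).
    by rewrite -[leRHS]mule1 lee_wpmul2l ?lee_fin// probability_le1.
  apply: le_trans (contr t _ (filtration_le (leq0n t) (FB k))) _.
  by rewrite exprS mulrCA EFinM lee_wpmul2l// lee_fin ltW.
pose f t w := ((b ^- t)%:E * (v t w)%:E).
have f0 t w : 0 <= f t w by rewrite mule_ge0// lee_fin// invr_ge0 exprn_ge0// ltW.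
have mf t : measurable_fun setT (f t).
  by apply: emeasurable_funM.
have q01 : (`|c / b| < 1)%R.
  by rewrite ger0_norm ?divr_ge0 ?ltW// ltr_pdivrMr// mul1r.
have sumB k : \int[P]_(w in B k) (\sum_(0 <= t <oo) f t w) < +oo.
  rewrite integral_nneseries//; last by move=> t; exact: measurable_funTS (mf t).
  apply: (@le_lt_trans _ _ (k%:R / (1 - c / b))%:E); last exact: ltry.
  apply: lime_le.
    by apply: is_cvg_nneseries => t _ _; exact: integral_ge0.
  apply: nearW => m.
  apply: (@le_trans _ _ (series (geometric k%:R (c / b)) m)%:E); last first.
    by rewrite lee_fin geometric_le_lim// divr_gt0.
  rewrite /series/= -sumEFin; apply: lee_sum => t _.
  rewrite ge0_integralZl//; last 3 first.
  - exact: measurable_funTS (mvE t).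
  - by move=> w _; rewrite lee_fin.
  - by rewrite lee_fin invr_ge0 exprn_ge0// ltW.
  apply: le_trans (lee_wpmul2l _ (intB k t)) _.
    by rewrite lee_fin invr_ge0 exprn_ge0// ltW.
  by rewrite -EFinM lee_fin expr_div_n mulrC mulrA.
have aeB : {ae P, forall w, forall k, B k w ->
    \sum_(0 <= t <oo) f t w \is a fin_num}.
  apply: ae_foralln => k; apply: integrable_ae => //.
  apply/integrableP; split.
    by apply: ge0_emeasurable_sum => // t _; exact: measurable_funTS (mf t).
  under eq_integral => w _ do rewrite gee0_abs ?nneseries_ge0//.
  exact: sumB.
apply: filterS aeB => w fin.
have /fin Sfin : B (Num.truncn (v 0%N w)).+1 w by exact/ltW/truncnS_gt.
exists (fine (\sum_(0 <= t <oo) f t w)) => t.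
rewrite -ler_pdivrMr ?exprn_gt0// mulrC -lee_fin fineK// EFinM.
by rewrite (nneseriesD1 (n := t))// leeDl// nneseries_ge0.
Qed.

End geometric_decay.

(** * The convergence theorem *)

Theorem theorem4p16
  (R : realType)
  (* sample space, loss and model class *)
  (dX : measure_display) (X : measurableType dX) (rho : probability X R)
  (H : completeNormedModType R) (dot : {dot H for idfun})
  (dot_norm : induces_norm dot)
  (l : H -> X -> R)
  (l_int : forall v, rho.-integrable setT (EFin \o l v))
  (M : set H)
  (loss := expected_loss rho l)
  (loss_min := loss_inf loss setT)
  (loss_diff : forall u, M u -> differentiable (loss : H -> R^o) u)
  (* filtered probability space *)
  (d : measure_display) (Omega : measurableType d) (P : probability Omega R)
  (F : nat -> set (set Omega)) (F_filtration : filtration F)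
  (* linear spaces *)
  (assoc : H -> set (set H))
  (u : nat -> Omega -> H)
  (T : nat -> Omega -> set H) (dim : nat -> Omega -> nat)
  (T_assoc : forall t w, assoc (u t w) (T t w))
  (T_dim : forall t w, subspace_of_dim (T t w) (dim t w))
  (T_meas : forall t v,
     fmeasurable (F t) (fun w => orthoproj dot (T t w) v : borel H))
  (* sample points and estimators *)
  (n : nat)
  (mu : forall t, R.-pker (g_sigma_algebraType (F t)) ~> X)
  (x : nat -> Omega -> n.-tuple X)
  (x_meas : forall t, fmeasurable (F t.+1) (x t))
  (x_iid : forall t, cond_iid P (mu t) (x t))
  (Phi : nat -> Omega -> n.-tuple X -> H -> H)
  (Phi_meas : forall t v, measurable_fun
     [set: (g_sigma_algebraType (F t) * n.-tuple X)%type]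
     (fun p => Phi t p.1 p.2 v : borel H))
  (Pn := fun t w v => Phi t w (x t w) v)
  (Pn_T : forall t w v, T t w (Pn t w v))
  (* algorithm *)
  (s : nat -> Omega -> R)
  (s_gt0 : forall t w, 0 < s t w)
  (s_meas : forall t, fmeasurable (F t) (s t))
  (Rt : nat -> Omega -> H -> H)
  (Rt_M : forall t w v, M (Rt t w v))
  (Rt_meas : forall t v, fmeasurable (F t) (fun w => Rt t w v : borel H))
  (g := fun t w => gradient dot loss (u t w))
  (u0_M : forall w, M (u 0%N w))
  (u_step : forall t w, u t.+1 w = Rt t w (u t w - s t w *: Pn t w (g t w)))
  (u_meas : forall t, fmeasurable (F t) (u t : Omega -> borel H))
  (g_meas : forall t, fmeasurable (F t) (g t : Omega -> borel H))
  (* assumptions *)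
  (L lambda CR cbias1 cvar1 cvar2 : R)
  (L_gt0 : 0 < L) (lambda_gt0 : 0 < lambda) (CR_gt0 : 0 < CR)
  (cbias1_gt0 : 0 < cbias1) (cvar1_gt0 : 0 < cvar1) (cvar2_ge0 : 0 <= cvar2)
  (loss_min_M_fin : loss_inf loss M \is a fin_num)
  (loss_smooth : restricted_smooth dot loss M assoc L)
  (loss_PL : polyak_lojasiewicz dot loss M lambda)
  (retraction : controlled_retraction loss u T Rt CR (fun _ _ => 0))
  (bias : bounded_bias dot P F T Pn cbias1)
  (variance : bounded_variance dot P F T Pn cvar1 cvar2)
  (kappa := fun t w => proj_ratio dot (T t w) (g t w))
  (sigma := fun t w =>
     cbias1 * s t w
     - s t w ^+ 2 * ((L + CR) / 2) * (cvar1 + cvar2 * (fine (kappa t w) - 1)))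
  (a := fun t w => 1 - 2 * lambda * (sigma t w / fine (kappa t w)))
  (gap := fun t w => ((loss (u t w))%:E - loss_min)%E) :
  (forall t Y, is_cond_exp P (F t) (gap t.+1) Y ->
     {ae P, forall w, (1 <= kappa t w < +oo)%E -> 0 < sigma t w ->
        (Y w <= (a t w)%:E * gap t w)%E})
  /\
  (forall abar b : R, abar < b -> b < 1 ->
     (forall t, {ae P, forall w,
        [/\ (1 <= kappa t w < +oo)%E, 0 < sigma t w & a t w <= abar]}) ->
     {ae P, forall w, exists C : R, forall t,
        (gap t w <= (C * b ^+ t)%:E)%E}).
Proof.
have [Fsig FM _] := F_filtration.
have M_u t w : M (u t w) by case: t => [|t]; rewrite ?u_step.
have lmin_fin : loss_min \is a fin_num.
  by apply: (loss_inf_fin_num lambda_gt0 _ loss_PL); exists (u 0%N point).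
pose v t w := loss (u t w) - fine loss_min.
have gapE t w : gap t w = (v t w)%:E by rewrite /gap -(fineK lmin_fin).
have v0 t w : 0 <= v t w.
  rewrite -lee_fin -gapE sube_ge0 ?lmin_fin//.
  by apply: ereal_inf_lbound; exists (u t w).
have PL t w : 2 * lambda * v t w <= `|g t w| ^+ 2.
  by rewrite -lee_fin EFinM -gapE; exact: loss_PL.
have mv t : fmeasurable (F t) (v t).
  apply: (@measurable_funB _ (g_sigma_algebraType (F t))) => //.
  apply: (measurable_comp_continuous_on (M := M)) => // z Mz.
  exact: differentiable_continuous (loss_diff _ Mz).
have mv' t : measurable_fun setT (v t.+1).
  exact: fmeasurable_measurable (Fsig t.+1) (FM t.+1) _ _ _ (mv t.+1).
have one_step t : exists h : Omega -> \bar R,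
    [/\ fmeasurable (F t) h, forall w, (0 <= h w)%E,
        forall A, F t A ->
          (\int[P]_(w in A) (v t.+1 w)%:E <= \int[P]_(w in A) h w)%E
      & {ae P, forall w, (1 <= kappa t w < +oo)%E -> 0 < sigma t w ->
                 (h w <= (a t w * v t w)%:E)%E}].
  have [YD ceD biasD] := bias t (g t) (g_meas t).
  have [YN ceN varN] := variance t (g t) (g_meas t).
  have descent w : v t.+1 w <= v t w - s t w * dot (g t w) (Pn t w (g t w))
      + (L + CR) / 2 * s t w ^+ 2 * `|Pn t w (g t w)| ^+ 2.
    rewrite /v u_step.
    have retr q : T t w q -> loss (Rt t w (u t w + q))
        <= loss (u t w + q) + CR / 2 * `|q| ^+ 2.
      by move=> Tq; have := retraction t w q Tq; rewrite addr0.
    have := retracted_step_le (s t w) (T_dim t w) (Pn_T t w (g t w))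
      (loss_smooth _ (M_u t w) _ (T_assoc t w)) retr.
    by rewrite -/(g t w); lra.
  have s0 w : 0 <= s t w by rewrite ltW.
  have LCR0 : 0 <= (L + CR) / 2 by rewrite divr_ge0// addr_ge0// ltW.
  have N0 w : 0 <= `|Pn t w (g t w)| ^+ 2 by rewrite sqr_ge0.
  have [h [mh h0 hint hle]] := cond_descent (Fsig t) (FM t) (mv' t) (mv t)
    (s_meas t) (v0 t.+1) (v0 t) s0 N0 LCR0 descent ceD ceN biasD varN.
  exists h; split=> //.
  apply: filterS hle => w hw kappa_fin sigma0; apply: le_trans hw _.
  rewrite lee_fin.
  exact: descent_le.
split=> [t Y|abar b abar_b b1 step].
  move=> [mY [Yp [Yn [[mX mYp Yp0 XYp] [_ _ Yn0 _] YE]]]].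
  have [h [mh h0 hint hle]] := one_step t.
  have Yph : {ae P, forall w, (Yp w <= h w)%E}.
    apply: (ae_le_of_le_integral (Fsig t) (FM t)) => // A FA.
    rewrite -XYp//; apply: le_trans (hint _ FA).
    rewrite le_eqVlt; apply/orP; left; apply/eqP; apply: eq_integral => w _.
    by rewrite funeposE gapE max_l// lee_fin.
  apply: filterS2 (filterI Yph YE) hle.
  move=> w [Yphw [_ ->]] hw kappa_fin sigma0.
  rewrite gapE -EFinM; apply: le_trans (hw kappa_fin sigma0).
  by apply: le_trans Yphw; rewrite geeDl// oppe_le0.
(* [abar] may be nonpositive, so the contraction factor is raised to a positive
   number that is still below [b]. *)
have [b0|b0] := ltP 0 b.
  pose c := Num.max abar (b / 2).
  have c0 : 0 < c by rewrite lt_max; apply/orP; right; lra.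
  have cb : c < b by rewrite gt_max abar_b/=; lra.
  suff : {ae P, forall w, exists C : R, forall t, (v t w <= C * b ^+ t)%R}.
    by apply: filterS => w [C vC]; exists C => t; rewrite gapE lee_fin.
  apply: (ae_geometric_decay F_filtration c0 cb v0 mv) => t A FA.
  have mA : measurable A by exact: FM FA.
  have [h [mh h0 hint hle]] := one_step t.
  have mvt : measurable_fun setT (fun w => (v t w)%:E).
    apply/measurable_EFinP.
    exact: fmeasurable_measurable (Fsig t) (FM t) _ _ _ (mv t).
  apply: le_trans (hint _ FA) _.
  rewrite -ge0_integralZl//; last 3 first.
  - exact: measurable_funTS mvt.
  - by move=> w _; rewrite lee_fin.
  - by rewrite lee_fin ltW.
  apply: ae_ge0_le_integral => //.
  - apply: measurable_funTS.
    exact: fmeasurable_measurable (Fsig t) (FM t) _ _ _ mh.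
  - by move=> w _; rewrite -EFinM lee_fin mulr_ge0// ltW.
  - by apply: measurable_funTS; exact: emeasurable_funM.
  move: hle (step t); apply: filterS2 => w hw [kappa_fin sigma0 a_abar] _.
  apply: le_trans (hw kappa_fin sigma0) _.
  by rewrite -EFinM lee_fin ler_wpM2r// (le_trans a_abar)// le_max lexx.
(* If [b <= 0] then [a_t < 0], and the nonnegative [h <= a_t v_t] forces
   [v_t = 0]. *)
have gap0 t : {ae P, forall w, v t w = 0}.
  have [h [mh h0 hint hle]] := one_step t.
  move: hle (step t); apply: filterS2 => w hw [kappa_fin sigma0 a_abar].
  have := le_trans (h0 w) (hw kappa_fin sigma0); rewrite lee_fin => av0.
  apply/eqP; rewrite eq_le v0 andbT; rewrite leNgt; apply/negP => vpos.
  by move: av0; rewrite pmulr_lge0//; lra.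
move: (ae_foralln gap0); apply: filterS => w vw0.
by exists 0 => t; rewrite gapE vw0 mul0r.
Qed.
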